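(* Let $X:I\times J\to\mathbb{S}^3$, $X(s,t)=\alpha(s)\cdot\beta(t)$, be a translation surface, where $\alpha,\beta$ are arc length curves in $\mathbb{S}^3$. If $\kappa_\alpha=\kappa_\beta=0$, then it is a CMC Clifford torus. Moreover, $\langle T_\alpha,T_\beta\rangle=C\in(-1,1)$ and the mean curvature is given by $$H=\frac{-C}{\sqrt{1-C^2}}.$$
   Context: $\mathbb{R}^4$ is identified with the quaternions, ''$\cdot$'' is quaternion multiplication, $\overline{x}$ is conjugation, $\langle\cdot,\cdot\rangle$ is the Euclidean inner product, and $\mathbb{S}^3$ is the group of unit quaternions with the induced metric. A translation surface is a regular surface locally parametrized by $X(s,t)=\alpha(s)\cdot\beta(t)$. For an arc length curve $\gamma$ in $\mathbb{S}^3$, $\kappa_\gamma=|\nabla_{\gamma'}\gamma'|$ with $\nabla$ the Levi-Civita connection of $\mathbb{S}^3$. $T_\alpha=\overline{\alpha}\cdot\alpha'$ and $T_\beta=\beta\cdot\overline{\beta'}$; regularity of $X$ means $\langle T_\alpha,T_\beta\rangle\ne\pm1$. Here $C$ denotes a constant. A Clifford torus is $C_{R_1,R_2}=\{x\in\mathbb{R}^4: x_1^2+x_2^2=R_1^2,\ x_3^2+x_4^2=R_2^2\}$ with $R_1,R_2>0$, $R_1^2+R_2^2=1$, up to isometries of $\mathbb{S}^3$; being a Clifford torus is understood locally for a parametrized surface. The mean curvature $H$ is half the trace of the second fundamental form in $\mathbb{S}^3$ with respect to the unit normal field $$N=\frac{\alpha'\cdot\beta'-\langle T_\alpha,T_\beta\rangle\,\alpha\cdot\beta}{\sqrt{1-\langle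 T_\alpha,T_\beta\rangle^2}};$$ CMC means constant mean curvature (including zero). *)

(* Defs.v *)
From HB Require Import structures.
From mathcomp Require Import all_boot all_order all_algebra.
From mathcomp Require Import all_classical all_reals all_analysis.

Set Implicit Arguments.
Unset Strict Implicit.
Unset Printing Implicit Defensive.

Import Order.TTheory GRing.Theory Num.Theory.
Import numFieldNormedType.Exports.

Local Open Scope classical_set_scope.
Local Open Scope ring_scope.

(* The row vector (x0, x1, x2, x3) is the quaternion x0 + x1 i + x2 j + x3 k.
   Its coordinates, usually numbered x_1, ..., x_4, are indexed from 0 here. *)
Definition qmul (R : realType) (x y : 'rV[R]_4) : 'rV[R]_4 :=
  \row_(i < 4)
    [:: x 0 0 * y 0 0 - x 0 1 * y 0 1 - x 0 2 * y 0 2 - x 0 3 * y 0 3;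
        x 0 0 * y 0 1 + x 0 1 * y 0 0 + x 0 2 * y 0 3 - x 0 3 * y 0 2;
        x 0 0 * y 0 2 - x 0 1 * y 0 3 + x 0 2 * y 0 0 + x 0 3 * y 0 1;
        x 0 0 * y 0 3 + x 0 1 * y 0 2 - x 0 2 * y 0 1 + x 0 3 * y 0 0]`_i.

Definition qconj (R : realType) (x : 'rV[R]_4) : 'rV[R]_4 :=
  \row_(i < 4) (if i == 0 then x 0 i else - x 0 i).

Definition dot (R : realType) (x y : 'rV[R]_4) : R := \sum_(i < 4) x 0 i * y 0 i.

(* The library norm `|x| on 'rV[R]_4 is the sup norm, not this one. *)
Definition enorm (R : realType) (x : 'rV[R]_4) : R := Num.sqrt (dot x x).

Definition S3 (R : realType) : set 'rV[R]_4 := [set x | enorm x = 1].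

(* The curves are functions on the whole of R, of which only the restriction to
   an open interval matters. *)
Definition smooth_on (R : realType) (I : set R) (g : R -> 'rV[R]_4) : Prop :=
  forall (n : nat) (s : R), I s -> derivable (derive1n n g) s 1.

Definition arc_length_curve (R : realType) (I : set R) (g : R -> 'rV[R]_4) : Prop :=
  [/\ smooth_on I g,
      forall s, I s -> S3 (g s) &
      forall s, I s -> enorm (derive1 g s) = 1].

(* The Levi-Civita connection of the sphere is the orthogonal projection of the
   Euclidean derivative onto the tangent space: this is the covariant derivative
   of the vector field V along the curve g in the sphere. *)
Definition cov_deriv (R : realType) (g V : R -> 'rV[R]_4) (s : R) : 'rV[R]_4 :=
  derive1 V s - dot (derive1 V s) (g s) *: g s.

Definition curvature (R : realType) (g : R -> 'rV[R]_4) (s : R) : R :=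
  enorm (cov_deriv g (derive1 g) s).

Definition T_alpha (R : realType) (a : R -> 'rV[R]_4) (s : R) : 'rV[R]_4 :=
  qmul (qconj (a s)) (derive1 a s).

Definition T_beta (R : realType) (b : R -> 'rV[R]_4) (t : R) : 'rV[R]_4 :=
  qmul (b t) (qconj (derive1 b t)).

(* Partial derivative of a map of (s, t), in s if i = 0 and in t if i = 1. *)
Definition partial (R : realType) (X : R -> R -> 'rV[R]_4) (i : 'I_2) (s t : R) :
    'rV[R]_4 :=
  if i == 0 then derive1 (X ^~ t) s else derive1 (X s) t.

Definition regular_surface (R : realType) (I J : set R) (X : R -> R -> 'rV[R]_4) :
    Prop :=
  forall s t, I s -> J t -> free [:: partial X 0 s t; partial X 1 s t].

Definition product_map (R : realType) (a b : R -> 'rV[R]_4) (s t : R) : 'rV[R]_4 :=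
  qmul (a s) (b t).

Definition translation_surface (R : realType) (I J : set R) (a b : R -> 'rV[R]_4) :
    Prop :=
  [/\ open I, is_interval I, open J & is_interval J] /\
  [/\ arc_length_curve I a, arc_length_curve J b &
      regular_surface I J (product_map a b)].

Definition unit_normal (R : realType) (a b : R -> 'rV[R]_4) (s t : R) : 'rV[R]_4 :=
  let c := dot (T_alpha a s) (T_beta b t) in
  (Num.sqrt (1 - c ^+ 2))^-1 *:
    (qmul (derive1 a s) (derive1 b t) - c *: qmul (a s) (b t)).

Definition first_form (R : realType) (X : R -> R -> 'rV[R]_4) (s t : R) : 'M[R]_2 :=
  \matrix_(i, j) dot (partial X i s t) (partial X j s t).

Definition cov_partial (R : realType) (X V : R -> R -> 'rV[R]_4) (i : 'I_2)
    (s t : R) : 'rV[R]_4 :=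
  if i == 0 then cov_deriv (X ^~ t) (V ^~ t) s else cov_deriv (X s) (V s) t.

(* Sign convention: II(U, V) = <nabla_U N, V>, that is, the shape operator is
   U |-> nabla_U N.  With the normal unit_normal this is the convention under
   which great circles a and b give H = - C / sqrt (1 - C^2); the convention
   II(U, V) = <nabla_U V, N> gives the opposite sign. *)
Definition second_form (R : realType) (X N : R -> R -> 'rV[R]_4) (s t : R) :
    'M[R]_2 :=
  \matrix_(i, j) dot (cov_partial X N i s t) (partial X j s t).

(* Half the trace of II with respect to the first fundamental form. *)
Definition mean_curvature (R : realType) (X N : R -> R -> 'rV[R]_4) (s t : R) : R :=
  \tr (second_form X N s t *m invmx (first_form X s t)) / 2.

Definition cmc (R : realType) (I J : set R) (X N : R -> R -> 'rV[R]_4) : Prop :=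
  exists h : R, forall s t, I s -> J t -> mean_curvature X N s t = h.

Definition clifford_torus (R : realType) (R1 R2 : R) : set 'rV[R]_4 :=
  [set x | x 0 0 ^+ 2 + x 0 1 ^+ 2 = R1 ^+ 2 /\ x 0 2 ^+ 2 + x 0 3 ^+ 2 = R2 ^+ 2].

Definition sphere_dist (R : realType) (x y : 'rV[R]_4) : R := acos (dot x y).

(* Isometries of the sphere as a metric space, for the Riemannian distance; only
   the values of phi on the sphere matter. *)
Definition sphere_isometry (R : realType) (phi : 'rV[R]_4 -> 'rV[R]_4) : Prop :=
  set_bij (@S3 R) (@S3 R) phi /\
  forall x y, S3 x -> S3 y -> sphere_dist (phi x) (phi y) = sphere_dist x y.

(* The image of X is an open piece of a torus congruent to clifford_torus R1 R2,
   i.e. the trace on this torus of an open set W of the ambient space. *)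
Definition is_clifford_torus (R : realType) (I J : set R)
    (X : R -> R -> 'rV[R]_4) : Prop :=
  exists (R1 R2 : R) (phi : 'rV[R]_4 -> 'rV[R]_4) (W : set 'rV[R]_4),
    [/\ 0 < R1, 0 < R2 & R1 ^+ 2 + R2 ^+ 2 = 1] /\
    [/\ sphere_isometry phi, open W &
        [set X s t | s in I & t in J] = W `&` phi @` clifford_torus R1 R2].

(* Main.v *)
(* A curve g of zero curvature in the sphere satisfies g'' = - g, so
   a s = cos s p + sin s u and b t = cos t q + sin t v with orthonormal pairs
   (p, u) and (q, v).  Hence T_alpha = conj p u and T_beta = q conj v are constant,
   and with C = <T_alpha, T_beta> = <u v, p q> the addition formulas give
     2 a(s) b(t) =   cos (s + t) (p q - u v) + sin (s + t) (p v + u q)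
                   + cos (s - t) (p q + u v) + sin (s - t) (u q - p v),
   where the four vectors are orthogonal with squared norms 2 - 2C, 2 - 2C,
   2 + 2C, 2 + 2C: a Clifford torus with R1^2 = (1 - C)/2 and R2^2 = (1 + C)/2.
   With w = sqrt (1 - C^2), the fundamental forms are [[1, -C], [-C, 1]] and
   [[0, -w], [-w, 0]]. *)

Require Import Defs.
From HB Require Import structures.
From mathcomp Require Import all_boot all_order all_algebra.
From mathcomp Require Import all_classical all_reals all_analysis.
From mathcomp Require Import ring lra.
Import Order.TTheory GRing.Theory Num.Theory.
Import numFieldNormedType.Exports.
Local Open Scope classical_set_scope.
Local Open Scope ring_scope.

(** * Coordinates, the inner product and quaternion algebra *)

Section Quaternions.
Context {R : realType}.
Implicit Types x y z w p q u v : 'rV[R]_4.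

Lemma forall_ord4 (P : 'I_4 -> Prop) : P 0 -> P 1 -> P 2 -> P 3 -> forall i, P i.
Proof.
move=> P0 P1 P2 P3 [[|[|[|[|//]]]] lti].
- by rewrite (_ : Ordinal _ = 0)//; exact/val_inj.
- by rewrite (_ : Ordinal _ = 1)//; exact/val_inj.
- by rewrite (_ : Ordinal _ = 2)//; exact/val_inj.
- by rewrite (_ : Ordinal _ = 3)//; exact/val_inj.
Qed.

Lemma rV4P x y : x 0 0 = y 0 0 -> x 0 1 = y 0 1 -> x 0 2 = y 0 2 ->
  x 0 3 = y 0 3 -> x = y.
Proof. by move=> *; apply/rowP; exact: forall_ord4. Qed.

Lemma sum_ord4 (V : nmodType) (F : 'I_4 -> V) :
  \sum_i F i = F 0 + F 1 + F 2 + F 3.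
Proof.
rewrite !big_ord_recl big_ord0 addr0 !addrA.
by congr (F _ + F _ + F _ + F _); exact/val_inj.
Qed.

Lemma dotE x y : dot x y =
  x 0 0 * y 0 0 + x 0 1 * y 0 1 + x 0 2 * y 0 2 + x 0 3 * y 0 3.
Proof. exact: sum_ord4. Qed.

Lemma dot_mx x y : dot x y = (x *m y^T) 0 0.
Proof. by rewrite mxE; apply: eq_bigr => i _; rewrite !mxE. Qed.

Lemma dotC x y : dot x y = dot y x.
Proof. by apply: eq_bigr => i _; rewrite mulrC. Qed.

Lemma dotDl x y z : dot (x + y) z = dot x z + dot y z.
Proof. by rewrite !dot_mx mulmxDl mxE. Qed.

Lemma dotZl k x y : dot (k *: x) y = k * dot x y.
Proof. by rewrite !dot_mx -scalemxAl mxE. Qed.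

Lemma dotNl x y : dot (- x) y = - dot x y.
Proof. by rewrite -scaleN1r dotZl mulN1r. Qed.

Lemma dotDr x y z : dot z (x + y) = dot z x + dot z y.
Proof. by rewrite dotC dotDl !(dotC z). Qed.

Lemma dotZr k x y : dot y (k *: x) = k * dot y x.
Proof. by rewrite dotC dotZl dotC. Qed.

Lemma dotNr x y : dot y (- x) = - dot y x.
Proof. by rewrite dotC dotNl dotC. Qed.

Lemma dotxx_ge0 x : 0 <= dot x x.
Proof. by apply: sumr_ge0 => i _; rewrite -expr2 sqr_ge0. Qed.

Lemma dotxx_eq0 x : dot x x = 0 -> x = 0.
Proof.
move=> /eqP; rewrite psumr_eq0; last by move=> i _; rewrite -expr2 sqr_ge0.
move=> /allP x0; apply/rowP => i; apply/eqP; rewrite mxE.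
by have := x0 i (mem_index_enum _); rewrite mulf_eq0 orbb.
Qed.

Lemma enorm_eq1 x : enorm x = 1 <-> dot x x = 1.
Proof.
rewrite /enorm; split=> [h|->]; last exact: sqrtr1.
by rewrite -(sqr_sqrtr (dotxx_ge0 x)) h expr1n.
Qed.

Lemma qmulZl k x y : qmul (k *: x) y = k *: qmul x y.
Proof. by apply: rV4P; rewrite !mxE /=; ring. Qed.

Lemma qmulZr k x y : qmul x (k *: y) = k *: qmul x y.
Proof. by apply: rV4P; rewrite !mxE /=; ring. Qed.

Lemma qmulDl x y z : qmul (x + y) z = qmul x z + qmul y z.
Proof. by apply: rV4P; rewrite !mxE /=; ring. Qed.

Lemma qmulDr x y z : qmul z (x + y) = qmul z x + qmul z y.
Proof. by apply: rV4P; rewrite !mxE /=; ring. Qed.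

Lemma dot_qmul2l x y z : dot (qmul x y) (qmul x z) = dot x x * dot y z.
Proof. by rewrite !dotE !mxE /=; ring. Qed.

Lemma dot_qmul2r x y z : dot (qmul y x) (qmul z x) = dot y z * dot x x.
Proof. by rewrite !dotE !mxE /=; ring. Qed.

(** Polarization in [x] and in [z] of the multiplicativity of the norm, |xz|^2 = |x|^2 |z|^2. *)
Lemma dot_qmul_polar x y z w :
  dot (qmul x z) (qmul y w) + dot (qmul y z) (qmul x w) = 2 * (dot x y * dot z w).
Proof. by rewrite !dotE !mxE /=; ring. Qed.

(** Multiplication by a conjugate is the adjoint of multiplication, on either side. This turns
    <T_alpha, T_beta> into <a' b', a b>. *)
Lemma dot_qmul_qconj x y z w :
  dot (qmul (qconj x) y) (qmul z (qconj w)) = dot (qmul y w) (qmul x z).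
Proof. by rewrite !dotE !mxE /=; ring. Qed.

(** The imaginary part of conj(x) y is bilinear and alternating in (x, y), so a rotation of the pair
    multiplies it by the determinant c^2 + s^2 = 1. The real part is <x, y>, which stays 0 for an
    orthogonal pair of equal norms. Along a great circle this makes [T_alpha] constant; the next
    lemma does the same for [T_beta]. *)
Lemma qconj_qmul_rot (c s : R) x y : c ^+ 2 + s ^+ 2 = 1 ->
  dot x x = dot y y -> dot x y = 0 ->
  qmul (qconj (c *: x + s *: y)) (- s *: x + c *: y) = qmul (qconj x) y.
Proof.
move=> cs xy xy0; rewrite -[RHS]scale1r -cs.
apply: rV4P; rewrite !mxE /=; [|ring..].
transitivity (c * s * (dot y y - dot x x) - 2 * s ^+ 2 * dot x y +
  (c ^+ 2 + s ^+ 2) * dot x y); first by rewrite !dotE; ring.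
rewrite xy subrr xy0 !mulr0 subr0 add0r -[LHS](mulr0 (c ^+ 2 + s ^+ 2)) -xy0 dotE.
by ring.
Qed.

Lemma qmul_qconj_rot (c s : R) x y : c ^+ 2 + s ^+ 2 = 1 ->
  dot x x = dot y y -> dot x y = 0 ->
  qmul (c *: x + s *: y) (qconj (- s *: x + c *: y)) = qmul x (qconj y).
Proof.
move=> cs xy xy0; rewrite -[RHS]scale1r -cs.
apply: rV4P; rewrite !mxE /=; [|ring..].
transitivity (c * s * (dot y y - dot x x) - 2 * s ^+ 2 * dot x y +
  (c ^+ 2 + s ^+ 2) * dot x y); first by rewrite !dotE; ring.
rewrite xy subrr xy0 !mulr0 subr0 add0r -[LHS](mulr0 (c ^+ 2 + s ^+ 2)) -xy0 dotE.
by ring.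
Qed.

End Quaternions.

(** * Derivatives of vector-valued functions of one variable *)

Section RowDerivative.
Context {R : realType}.

Lemma is_derive_rV {n} {f : R -> 'rV[R]_n.+1} {s : R} {df} :
  is_derive s 1 f df <-> forall i, is_derive s 1 (fun x => f x 0 i) (df 0 i).
Proof.
split=> [[df1 df2] i|H].
  split; first by have /derivable_mxP := df1; exact.
  by rewrite -df2 derive_mx// mxE.
have fs : derivable f s 1.
  by apply/derivable_mxP => j i; rewrite (ord1 j); case: (H i).
split=> //; rewrite derive_mx//; apply/rowP => i; rewrite mxE.
by case: (H i).
Qed.

Lemma is_derive_dot {f g : R -> 'rV[R]_4} {s : R} {df dg} :
  is_derive s 1 f df -> is_derive s 1 g dg ->
  is_derive s 1 (fun x => dot (f x) (g x)) (dot df (g s) + dot (f s) dg).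
Proof.
move=> /is_derive_rV Hf /is_derive_rV Hg.
rewrite (_ : (fun _ => _) = \sum_(i < 4) ((fun x => f x 0 i) * (fun x => g x 0 i))).
  apply: is_derive_eq; rewrite /dot -big_split/=; apply: eq_bigr => i _.
  by rewrite addrC /GRing.scale/= [X in _ + X]mulrC.
by apply/funext => x; rewrite fct_sumE.
Qed.

Lemma near_derive1_eq {V : normedModType R} {I : set R} {f g : R -> V} {s : R} :
  open I -> I s -> {in I, f =1 g} -> derive1 f s = derive1 g s.
Proof.
move=> oI Is fg; rewrite !derive1E; apply: near_eq_derive.
by apply: filterS (open_nbhs_nbhs (conj oI Is)) => x Ix; apply: fg; rewrite inE.
Qed.

Lemma is_derive_circle (A B : 'rV[R]_4) (s : R) :
  is_derive s 1 (fun x => cos x *: A + sin x *: B) (- sin s *: A + cos s *: B).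
Proof.
apply/is_derive_rV => i; rewrite !mxE.
rewrite (_ : (fun _ => _) = cos * cst (A 0 i) + sin * cst (B 0 i)); last first.
  by apply/funext => x; rewrite !mxE.
apply: is_derive_eq; rewrite /GRing.scale/= !mulr0 !add0r.
by rewrite mulrC [X in _ + X]mulrC.
Qed.

Lemma derive0_constant {I : set R} {f : R -> R} : is_interval I ->
  (forall s, I s -> is_derive s 1 f 0) -> forall s t, I s -> I t -> f s = f t.
Proof.
move=> iI f0; suff H s t : s <= t -> I s -> I t -> f s = f t.
  by move=> s t Is It; case: (leP s t) => [/H|/ltW /H h]; [exact|exact/esym/h].
move=> st Is It; have sub x : x \in `[s, t] -> I x.
  by rewrite in_itv/= => xst; exact: (iI _ _ Is It).
have [||c _] := @MVT_segment R f (cst 0) _ _ st.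
- by move=> x /subset_itv_oo_cc/sub; exact: f0.
- apply: continuous_in_subspaceT => x /set_mem/sub/f0[d _].
  exact/differentiable_continuous/derivable1_diffP.
- by rewrite mul0r => /eqP; rewrite subr_eq0 => /eqP ->.
Qed.

End RowDerivative.

(** * Spherical curves of zero curvature are great circles *)

Section GreatCircle.
Context {R : realType}.
Variables (I : set R) (g : R -> 'rV[R]_4).
Hypotheses (oI : open I) (iI : is_interval I).

Lemma is_derive_locally_cst {f : R -> R} {c s df : R} :
  I s -> {in I, f =1 cst c} -> is_derive s 1 f df -> df = 0.
Proof.
move=> Is fc [_ <-].
by rewrite -derive1E (near_derive1_eq oI Is fc) derive1_cst.
Qed.

Hypotheses (ag : arc_length_curve I g) (kg : forall s, I s -> curvature g s = 0).

Lemma is_derive_curve {s : R} : I s -> is_derive s 1 g (derive1 g s).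
Proof. by move=> Is; rewrite derive1E; apply: derivableP; case: ag => /(_ 0 s Is). Qed.

Lemma is_derive_velocity {s : R} :
  I s -> is_derive s 1 (derive1 g) (derive1 (derive1 g) s).
Proof.
by move=> Is; rewrite derive1E; apply: derivableP; case: ag => /(_ 1 s Is).
Qed.

Lemma dot_curve {s : R} : I s -> dot (g s) (g s) = 1.
Proof. by case: ag => _ + _ => /[apply] /enorm_eq1. Qed.

Lemma dot_velocity {s : R} : I s -> dot (derive1 g s) (derive1 g s) = 1.
Proof. by case: ag => _ _ /[apply] /enorm_eq1. Qed.

Lemma dot_curve_velocity {s : R} : I s -> dot (g s) (derive1 g s) = 0.
Proof.
move=> Is; have gs := is_derive_curve Is.
have := is_derive_locally_cst Is _ (is_derive_dot gs gs).
move/(_ 1) => H; have : dot (derive1 g s) (g s) + dot (g s) (derive1 g s) = 0.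
  by apply: H => x /set_mem Ix; rewrite dot_curve.
rewrite dotC; lra.
Qed.

(** Differentiating <g, g'> = 0 gives <g, g''> = -1, so the covariant derivative of g' is g'' + g,
    and zero curvature makes it vanish. *)
Lemma acceleration {s : R} : I s -> derive1 (derive1 g) s = - g s.
Proof.
move=> Is; have gs := is_derive_curve Is; have gs' := is_derive_velocity Is.
have : dot (derive1 g s) (derive1 g s) + dot (g s) (derive1 (derive1 g) s) = 0.
  apply: (is_derive_locally_cst (c := 0) Is _ (is_derive_dot gs gs')).
  by move=> x /set_mem Ix; rewrite dot_curve_velocity.
rewrite dot_velocity// => /eqP; rewrite addrC addr_eq0 => /eqP gg''.
have := kg _ Is; rewrite /curvature /cov_deriv dotC gg'' scaleN1r opprK => /eqP.
rewrite sqrtr_eq0 => le0; apply/eqP; rewrite -addr_eq0; apply/eqP.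
by apply: dotxx_eq0; apply/eqP; rewrite eq_le le0 dotxx_ge0.
Qed.

Lemma great_circle {s0} : I s0 ->
  exists p u, [/\ dot p p = 1, dot u u = 1, dot p u = 0 &
    forall s, I s -> g s = cos s *: p + sin s *: u /\
                     derive1 g s = - sin s *: p + cos s *: u].
Proof.
move=> Is0.
(* [P] and [U] rotate the frame (g, g') back by the angle s. Their derivatives vanish because g'' =
   -g, so they are constant on the interval; their values are the required pair, and the inverse
   rotation recovers g and g'. *)
pose P s := cos s *: g s - sin s *: derive1 g s.
pose U s := sin s *: g s + cos s *: derive1 g s.
have cPU s : I s -> P s = P s0 /\ U s = U s0.
  move=> Is; split; apply/rowP => i.
    apply: (derive0_constant (f := fun x => P x 0 i) iI) => // x Ix.
    have /is_derive_rV/(_ i) g1 := is_derive_curve Ix.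
    have /is_derive_rV/(_ i) g2 := is_derive_velocity Ix.
    rewrite (_ : (fun _ => _) = cos * (fun x => g x 0 i) -
      sin * (fun x => derive1 g x 0 i)); last by apply/funext => y; rewrite !mxE.
    apply: is_derive_eq; rewrite acceleration// mxE /GRing.scale/=. ring.
  apply: (derive0_constant (f := fun x => U x 0 i) iI) => // x Ix.
  have /is_derive_rV/(_ i) g1 := is_derive_curve Ix.
  have /is_derive_rV/(_ i) g2 := is_derive_velocity Ix.
  rewrite (_ : (fun _ => _) = sin * (fun x => g x 0 i) +
    cos * (fun x => derive1 g x 0 i)); last by apply/funext => y; rewrite !mxE.
  apply: is_derive_eq; rewrite acceleration// mxE /GRing.scale/=. ring.
have cs := cos2Dsin2 s0.
exists (P s0), (U s0); split.
- rewrite !(dotDl, dotDr, dotNl, dotNr, dotZl, dotZr).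
  rewrite (dotC (derive1 g s0)) dot_curve_velocity// dot_curve// dot_velocity//.
  by rewrite -[RHS]cs; ring.
- rewrite !(dotDl, dotDr, dotNl, dotNr, dotZl, dotZr).
  rewrite (dotC (derive1 g s0)) dot_curve_velocity// dot_curve// dot_velocity//.
  by rewrite -[RHS]cs; ring.
- rewrite !(dotDl, dotDr, dotNl, dotNr, dotZl, dotZr).
  rewrite (dotC (derive1 g s0)) dot_curve_velocity// dot_curve// dot_velocity//.
  by ring.
- move=> s Is; have [<- <-] := cPU s Is; have cs' := cos2Dsin2 s.
  split; apply/rowP => i; rewrite !mxE.
    by rewrite -[LHS]mul1r -cs'; ring.
  by rewrite -[LHS]mul1r -cs'; ring.
Qed.

End GreatCircle.

(** * Open pieces of a Clifford torus *)

Section CliffordTorus.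
Context {R : realType}.

(** The angle is asin(y2 / r): the sign of [y1] selects the half circle on which the cosine is the
    positive root, and e <= 1 <= pi/2 keeps all angles where sin is increasing. *)
Lemma polar_angle {r e y1 y2 : R} : 0 < r -> 0 < e <= 1 ->
  y1 ^+ 2 + y2 ^+ 2 = r ^+ 2 -> 0 < y1 -> `|y2| < r * sin e ->
  exists th, [/\ `|th| < e, y1 = r * cos th & y2 = r * sin th].
Proof.
move=> r0 /andP[e0 e1] y12 y1_gt0 y2e.
have rn0 : r != 0 by rewrite gt_eqF.
have pi2 : 1 <= pi / 2 :> R by rewrite pihalf_ge1.
have : `|y2 / r| < sin e.
  by rewrite normrM normfV (gtr0_norm r0) ltr_pdivrMr// mulrC.
rewrite ltr_norml => /andP[lo hi].
have se1 := sin_le1 e.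
have yb : -1 <= y2 / r <= 1 by apply/andP; split; lra.
have sth : sin (asin (y2 / r)) = y2 / r by rewrite asinK// in_itv.
exists (asin (y2 / r)); split.
- have thI : asin (y2 / r) \in `[- (pi / 2), pi / 2].
    by rewrite in_itv/= asin_geNpi2// asin_lepi2.
  have eI : e \in `[- (pi / 2), pi / 2] by rewrite in_itv/=; apply/andP; split; lra.
  have NeI : - e \in `[- (pi / 2), pi / 2] by rewrite in_itv/=; apply/andP; split; lra.
  rewrite ltr_norml -(ltr_sin NeI thI) -(ltr_sin thI eI).
  by rewrite sinN sth lo hi.
- rewrite cos_asin// (_ : 1 - _ = (y1 / r) ^+ 2).
    by rewrite sqrtr_sqr gtr0_norm ?divr_gt0// mulrC divfK.
  by rewrite !expr_div_n -[1](divff (expf_neq0 2 rn0)) -mulrBl -y12 addrK.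
- by rewrite sth mulrC divfK.
Qed.

Lemma continuous_coord_mulmx {n k : nat} (B : 'M[R]_(n.+1, k.+1)) (j : 'I_k.+1) :
  continuous (fun x : 'rV[R]_n.+1 => (x *m B) 0 j).
Proof.
move=> x; rewrite (_ : (fun _ => _) = fun y : 'rV[R]_n.+1 => \sum_i y 0 i * B i j).
  apply: continuous_big => [|i _ y]; first exact: add_continuous.
  by apply: continuousM; [exact: coord_continuous|exact: cst_continuous].
by apply/funext => y; rewrite mxE.
Qed.

Lemma open_gt0 (T : topologicalType) (f : T -> R) :
  continuous f -> open [set x | 0 < f x].
Proof. by move=> /continuousP cf; exact: (cf [set y | 0 < y] (@open_gt R 0)). Qed.

Lemma mulmx_orthogonal_sphere_isometry (A : 'M[R]_4) :
  A *m A^T = 1%:M -> sphere_isometry (fun x => x *m A).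
Proof.
move=> AAT; have ATA : A^T *m A = 1%:M by exact: mulmx1C.
have dA x y : dot (x *m A) (y *m A) = dot x y.
  by rewrite !dot_mx trmx_mul mulmxA -(mulmxA x) AAT mulmx1.
split; last by move=> x y _ _; rewrite /sphere_dist dA.
split.
- by move=> x /=; rewrite /S3/= /enorm dA.
- by move=> x y _ _ /(congr1 (mulmx^~ A^T)); rewrite -!mulmxA AAT !mulmx1.
- move=> x Sx; exists (x *m A^T); last by rewrite -mulmxA ATA mulmx1.
  by rewrite /S3/= /enorm -dA -mulmxA ATA mulmx1.
Qed.

Definition torus_point (R1 R2 : R) (x y : R) : 'rV[R]_4 :=
  \row_(i < 4) [:: R1 * cos x; R1 * sin x; R2 * cos y; R2 * sin y]`_i.

Lemma open_ball_radius {I : set R} {s} : open I -> I s ->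
  exists2 e, 0 < e & forall s', `|s' - s| < e -> I s'.
Proof.
move=> oI Is; have /nbhs_ballP[e /= e0 H] := open_nbhs_nbhs (conj oI Is).
by exists e => // s' se; apply: H; rewrite /ball/= distrC.
Qed.

(** The change of parameters (s, t) to (s + t, s - t) is invertible, so each small square of
    parameters covers a whole neighbourhood in the torus of the image of its centre. The open set
    [W] is a union of such neighbourhoods, each meeting the torus only inside the image. *)
Lemma is_clifford_torus_of_angles (I J : set R) (X : R -> R -> 'rV[R]_4)
    (A : 'M[R]_4) (R1 R2 : R) :
  open I -> open J -> A *m A^T = 1%:M ->
  0 < R1 -> 0 < R2 -> R1 ^+ 2 + R2 ^+ 2 = 1 ->
  (forall s t, I s -> J t -> X s t = torus_point R1 R2 (s + t) (s - t) *m A) ->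
  is_clifford_torus I J X.
Proof.
move=> oI oJ AAT R1_gt0 R2_gt0 R12 XE.
have ATA : A^T *m A = 1%:M by exact: mulmx1C.
(* Coordinates of [x] in the orthonormal basis formed by the rows of [A]. The pairs (y1, y2) and
   (z1, z2) are these coordinates rotated back by the angles p and q. *)
pose c (x : 'rV[R]_4) i := (x *m A^T) 0 i.
pose y1 p x := cos p * c x 0 + sin p * c x 1.
pose y2 p x := cos p * c x 1 - sin p * c x 0.
pose z1 q x := cos q * c x 2 + sin q * c x 3.
pose z2 q x := cos q * c x 3 - sin q * c x 2.
(* In coordinates rotated by the angles s + t and s - t, the image of a square
   with centre (s, t) contains the part of the torus with small y2 and z2, and
   y1, z1 > 0; W is the union of these conditions over all small squares. *)
pose P (i : R * R * R) := let: (s, t, e) := i in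
  [/\ 0 < e <= 1, I s, J t & (forall s', `|s' - s| < e -> I s') /\
    (forall t', `|t' - t| < e -> J t')].
pose O (i : R * R * R) := let: (s, t, e) := i in
  [set x | 0 < y1 (s + t) x] `&` [set x | 0 < R1 * sin e - `|y2 (s + t) x|] `&`
  ([set x | 0 < z1 (s - t) x] `&` [set x | 0 < R2 * sin e - `|z2 (s - t) x|]).
exists R1, R2, (fun x => x *m A), (\bigcup_(i in P) O i).
split=> //; split.
- exact: mulmx_orthogonal_sphere_isometry.
- apply: bigcup_open => -[[s t] e] _.
  have cc i : continuous (c ^~ i) by exact: continuous_coord_mulmx.
  have cZ (k : R) (f : 'rV[R]_4 -> R) : continuous f -> continuous (fun x => k * f x).
    by move=> cf x; apply: continuousM; [exact: cst_continuous|exact: cf].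
  have cN (k : R) (f : 'rV[R]_4 -> R) :
      continuous f -> continuous (fun x => k - `|f x|).
    move=> cf x; apply: (@continuousB _ _ _ (cst k) (fun x => `|f x|)).
      exact: cst_continuous.
    by apply: continuous_comp; [exact: cf|exact: norm_continuous].
  have cD (f h : 'rV[R]_4 -> R) :
      continuous f -> continuous h -> continuous (fun x => f x + h x).
    by move=> cf ch x; exact: (continuousD (cf x) (ch x)).
  have cB (f h : 'rV[R]_4 -> R) :
      continuous f -> continuous h -> continuous (fun x => f x - h x).
    by move=> cf ch x; exact: (continuousB (cf x) (ch x)).
  repeat apply: openI; apply: open_gt0; rewrite /y1 /y2 /z1 /z2.
  + by apply: cD; exact/cZ/cc.
  + by apply/cN/cB; exact/cZ/cc.
  + by apply: cD; exact/cZ/cc.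
  + by apply/cN/cB; exact/cZ/cc.
- apply/seteqP; split=> [_ [s Is [t Jt <-]]|x [[[[s t] e]]]].
  + rewrite XE//; split; last first.
      exists (torus_point R1 R2 (s + t) (s - t)) => //; rewrite /clifford_torus/= !mxE/=.
      by rewrite !exprMn -!mulrDr !cos2Dsin2 !mulr1.
    have [e1 e1_gt0 He1] := open_ball_radius oI Is.
    have [e2 e2_gt0 He2] := open_ball_radius oJ Jt.
    (* The bound 1 makes sin e positive and meets the condition on e in [P]. *)
    pose e := Num.min 1 (Num.min e1 e2).
    have e0 : 0 < e by rewrite !lt_min ltr01 e1_gt0.
    have e01 : 0 < e <= 1 by rewrite e0 ge_min lexx.
    have se : 0 < sin e.
      by apply: sin2_gt0; rewrite e0/=; apply: (le_lt_trans (y := 1)); [rewrite ge_min lexx|lra].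
    exists (s, t, e).
      split=> //; split=> u ue.
        by apply: He1; apply: (lt_le_trans ue); rewrite !ge_min lexx orbT.
      by apply: He2; apply: (lt_le_trans ue); rewrite !ge_min lexx !orbT.
    have cE i : c (torus_point R1 R2 (s + t) (s - t) *m A) i =
        torus_point R1 R2 (s + t) (s - t) 0 i by rewrite /c -mulmxA AAT mulmx1.
    (* At the centre of the square the rotated coordinates are (R1, 0) and (R2, 0). *)
    have rot (r p : R) : cos p * (r * cos p) + sin p * (r * sin p) = r.
      by rewrite -[RHS]mulr1 -(cos2Dsin2 p); ring.
    have rot0 (r p : R) : cos p * (r * sin p) - sin p * (r * cos p) = 0 by ring.
    rewrite /O/= /y1 /y2 /z1 /z2 !cE !mxE/= !rot !rot0 normr0 !subr0.
    by rewrite R1_gt0 R2_gt0 !mulr_gt0.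
  + move=> [e01 Is Jt [He1 He2]] [[/= hy1 hy2] [/= hz1 hz2]] [w [/= w1 w2] xE].
    have cE i : c x i = w 0 i by rewrite /c -xE -mulmxA AAT mulmx1.
    have rot (p a b : R) :
        (cos p * a + sin p * b) ^+ 2 + (cos p * b - sin p * a) ^+ 2 = a ^+ 2 + b ^+ 2.
      by rewrite -[RHS]mul1r -(cos2Dsin2 p); ring.
    move: hy1 hy2 hz1 hz2; rewrite !subr_gt0 => hy1 hy2 hz1 hz2.
    have [|th [th_lt thc ths]] := polar_angle R1_gt0 e01 _ hy1 hy2.
      by rewrite /y1 /y2 !cE rot.
    have [|ze [ze_lt zec zes]] := polar_angle R2_gt0 e01 _ hz1 hz2.
      by rewrite /z1 /z2 !cE rot.
    (* The new parameters solve s' + t' = s + t + th and s' - t' = s - t + ze; both shifts are less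
       than e in absolute value. *)
    have s'I : I (s + (th + ze) / 2).
      apply: He1; move: th_lt ze_lt; rewrite !ltr_norml => /andP[? ?] /andP[? ?].
      by apply/andP; split; lra.
    have t'J : J (t + (th - ze) / 2).
      apply: He2; move: th_lt ze_lt; rewrite !ltr_norml => /andP[? ?] /andP[? ?].
      by apply/andP; split; lra.
    exists (s + (th + ze) / 2) => //; exists (t + (th - ze) / 2) => //.
    rewrite XE// -xE; congr (_ *m A).
    rewrite (_ : _ + _ + _ = (s + t) + th); last by field.
    rewrite (_ : _ + _ - _ = (s - t) + ze); last by field.
    move: thc ths zec zes; rewrite /y1 /y2 /z1 /z2 !cE => thc ths zec zes.
    have unrot (p a b : R) : cos p * (cos p * a + sin p * b) -
        sin p * (cos p * b - sin p * a) = a /\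
        sin p * (cos p * a + sin p * b) + cos p * (cos p * b - sin p * a) = b.
      by split; rewrite -[RHS]mul1r -(cos2Dsin2 p); ring.
    apply: rV4P; rewrite !mxE/=.
    * by rewrite cosD; have [<- _] := unrot (s + t) (w 0 0) (w 0 1); rewrite thc ths; ring.
    * by rewrite sinD; have [_ <-] := unrot (s + t) (w 0 0) (w 0 1); rewrite thc ths; ring.
    * by rewrite cosD; have [<- _] := unrot (s - t) (w 0 2) (w 0 3); rewrite zec zes; ring.
    * by rewrite sinD; have [_ <-] := unrot (s - t) (w 0 2) (w 0 3); rewrite zec zes; ring.
Qed.

End CliffordTorus.

(** * Linear algebra of the two fundamental forms *)

Section Surface.
Context {R : realType}.
Implicit Types x y z w p q u v : 'rV[R]_4.

Lemma free2_neq (x y : 'rV[R]_4) k : free [:: x; y] -> x != k *: y.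
Proof.
rewrite free_cons span_seq1 => /andP[xy _].
by apply: contra xy => /eqP ->; exact/memvZ/memv_line.
Qed.

(** Strict Cauchy-Schwarz: for k = 1 and k = -1, |x - k y|^2 = 2 (1 - k c) is positive by linear
    independence. *)
Lemma sqr_lt1_of_free x y c : free [:: x; y] ->
  dot x x = 1 -> dot y y = 1 -> dot x y = c -> -1 < c < 1.
Proof.
move=> xy xx yy xyc.
have pos (k : R) : k ^+ 2 = 1 -> 0 < 1 - k * c.
  move=> k2; have ne : x - k *: y != 0 by rewrite subr_eq0 free2_neq.
  have E : dot (x - k *: y) (x - k *: y) = 2 * (1 - k * c).
    rewrite !(dotDl, dotDr, dotNl, dotNr, dotZl, dotZr) (dotC y) xx yy xyc.
    by transitivity (1 + k ^+ 2 - 2 * k * c); [ring|rewrite k2; ring].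
  have : 0 < dot (x - k *: y) (x - k *: y).
    rewrite lt0r dotxx_ge0 andbT; apply: contra ne => /eqP/dotxx_eq0 ->//.
  by rewrite E pmulr_rgt0.
have := pos 1 (expr1n _ _); have := pos (-1); rewrite sqrrN expr1n => /(_ erefl).
by move=> ? ?; apply/andP; split; lra.
Qed.

Lemma ord2_ind (P : 'I_2 -> Prop) : P 0 -> P 1 -> forall i, P i.
Proof.
move=> P0 P1 [[|[|//]] lti].
- by rewrite (_ : Ordinal _ = 0)//; exact/val_inj.
- by rewrite (_ : Ordinal _ = 1)//; exact/val_inj.
Qed.

Lemma half_trace_shape_operator (F S : 'M[R]_2) (c : R) :
  let w := Num.sqrt (1 - c ^+ 2) in -1 < c < 1 ->
  F 0 0 = 1 -> F 0 1 = - c -> F 1 0 = - c -> F 1 1 = 1 ->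
  S 0 0 = 0 -> S 0 1 = - w -> S 1 0 = - w -> S 1 1 = 0 ->
  \tr (S *m invmx F) / 2 = - c / w.
Proof.
move=> w /andP[c1 c2] F00 F01 F10 F11 S00 S01 S10 S11.
have d0 : 0 < 1 - c ^+ 2 by nra.
have w2 : w ^+ 2 = 1 - c ^+ 2 by rewrite sqr_sqrtr// ltW.
have w0 : w != 0 by rewrite gt_eqF// sqrtr_gt0.
have sum2 (f : 'I_2 -> R) : \sum_i f i = f 0 + f 1.
  rewrite !big_ord_recl big_ord0 addr0.
  by congr (f _ + f _); exact/val_inj.
(* The inverse of [F]: its adjugate divided by its determinant 1 - c^2 = w^2. *)
pose G : 'M[R]_2 := \matrix_(i, j) (if i == j then w ^- 2 else c * w ^- 2).
have FG : F *m G = 1%:M.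
  have dV : (1 - c ^+ 2) * w ^- 2 = 1 by rewrite -w2 mulfV ?expf_neq0.
  apply/matrixP => i j; rewrite !mxE sum2 !mxE.
  elim/ord2_ind: i; elim/ord2_ind: j => /=; rewrite ?F00 ?F01 ?F10 ?F11 ?mul1r.
  - by rewrite -[RHS]dV; ring.
  - by rewrite mulNr subrr.
  - by rewrite mulNr addNr.
  - by rewrite -[RHS]dV; ring.
have -> : invmx F = G.
  have [Fu _] := mulmx1_unit FG.
  by rewrite -[LHS]mulmx1 -FG mulKmx.
by rewrite /mxtrace sum2 !mxE !sum2 !mxE /= S00 S01 S10 S11; field.
Qed.

End Surface.

(** * Differentiating linear expressions in a great circle *)

Section CircleDerivative.
Context {R : realType}.
Variables (I : set R) (g : R -> 'rV[R]_4) (p u : 'rV[R]_4).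
Hypothesis oI : open I.
Hypothesis gE : forall s, I s -> g s = cos s *: p + sin s *: u /\
                                 derive1 g s = - sin s *: p + cos s *: u.

(** The formula reflects g'' = -g. Writing f as an explicit combination of cos and sin with constant
    vectors avoids differentiating through [L] and [M]. It serves for the partial derivatives of
    both the surface and its normal. *)
Lemma derive1_linear_circle (L M : 'rV[R]_4 -> 'rV[R]_4) (f : R -> 'rV[R]_4) s :
  linear L -> linear M -> I s -> {in I, forall x, f x = L (g x) + M (derive1 g x)} ->
  derive1 f s = L (derive1 g s) - M (g s).
Proof.
move=> linL linM Is fE.
have comb (N : 'rV[R]_4 -> 'rV[R]_4) : linear N -> forall (c d : R) x y,
    N (c *: x + d *: y) = c *: N x + d *: N y.
  by move=> linN c d x y; rewrite linN (GRing.scalable_linear linN).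
rewrite (near_derive1_eq oI Is (g := fun x =>
  cos x *: (L p + M u) + sin x *: (L u - M p))) => [|x xI]; last first.
  have [gx g'x] := gE _ (set_mem xI); rewrite fE// g'x gx (comb L)// (comb M)//.
  by apply/rowP => i; rewrite !mxE; ring.
have D := is_derive_circle (L p + M u) (L u - M p) s.
rewrite derive1E derive_val; have [gs g's] := gE _ Is.
rewrite g's gs (comb L)// (comb M)//; apply/rowP => i; rewrite !mxE; ring.
Qed.

End CircleDerivative.

Lemma cov_partialE0 {R : realType} (X V : R -> R -> 'rV[R]_4) s t :
  cov_partial X V 0 s t = cov_deriv (X ^~ t) (V ^~ t) s.
Proof. by rewrite /cov_partial/=. Qed.

Lemma cov_partialE1 {R : realType} (X V : R -> R -> 'rV[R]_4) s t :
  cov_partial X V 1 s t = cov_deriv (X s) (V s) t.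
Proof. by rewrite /cov_partial/=. Qed.

(** * The product of two great circles *)

Section TranslationSurface.
Context {R : realType}.
Variables (I J : set R) (a b : R -> 'rV[R]_4) (p u q v : 'rV[R]_4).
Hypotheses (oI : open I) (oJ : open J).
Hypotheses (pp : dot p p = 1) (uu : dot u u = 1) (pu : dot p u = 0).
Hypotheses (qq : dot q q = 1) (vv : dot v v = 1) (qv : dot q v = 0).
Hypothesis aE : forall s, I s -> a s = cos s *: p + sin s *: u /\
                                 derive1 a s = - sin s *: p + cos s *: u.
Hypothesis bE : forall t, J t -> b t = cos t *: q + sin t *: v /\
                                 derive1 b t = - sin t *: q + cos t *: v.

Let C := dot (qmul u v) (qmul p q).
Let X := product_map a b.
Let N := unit_normal a b.

(** The factor [k] covers the zero map, used for the surface, and the coefficients of the normal. *)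
Lemma linear_qmull (k : R) (z : 'rV[R]_4) : linear (fun x => k *: qmul x z).
Proof. by move=> c x y; rewrite qmulDl qmulZl; apply/rowP => i; rewrite !mxE; ring. Qed.

Lemma linear_qmulr (k : R) (z : 'rV[R]_4) : linear (fun x => k *: qmul z x).
Proof. by move=> c x y; rewrite qmulDr qmulZr; apply/rowP => i; rewrite !mxE; ring. Qed.

Lemma orthonormal_rot (x y : 'rV[R]_4) (s : R) :
  dot x x = 1 -> dot y y = 1 -> dot x y = 0 ->
  [/\ dot (cos s *: x + sin s *: y) (cos s *: x + sin s *: y) = 1,
      dot (- sin s *: x + cos s *: y) (- sin s *: x + cos s *: y) = 1 &
      dot (cos s *: x + sin s *: y) (- sin s *: x + cos s *: y) = 0].
Proof.
move=> xx yy xy; have cs := cos2Dsin2 s.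
rewrite !(dotDl, dotDr, dotZl, dotZr) (dotC y) xx yy xy.
by split; rewrite -?[RHS]cs; ring.
Qed.

Lemma dot_T s t : I s -> J t -> dot (T_alpha a s) (T_beta b t) = C.
Proof.
move=> Is Jt; rewrite /T_alpha /T_beta.
have [-> ->] := aE _ Is; have [-> ->] := bE _ Jt.
rewrite qconj_qmul_rot ?qmul_qconj_rot ?cos2Dsin2 ?pp ?qq//.
exact: dot_qmul_qconj.
Qed.

(** Unit factors act by isometries, which gives the first two groups; the last equation is
    [dot_qmul_polar], whose right side vanishes by orthogonality. All inner products of the four
    products then depend on the single number <yw, xz>. *)
Lemma gram_qmul (x y z w : 'rV[R]_4) :
  dot x x = 1 -> dot y y = 1 -> dot x y = 0 ->
  dot z z = 1 -> dot w w = 1 -> dot z w = 0 ->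
  [/\ [/\ dot (qmul x z) (qmul x z) = 1, dot (qmul x w) (qmul x w) = 1,
       dot (qmul y z) (qmul y z) = 1 & dot (qmul y w) (qmul y w) = 1],
    [/\ dot (qmul x z) (qmul x w) = 0, dot (qmul x z) (qmul y z) = 0,
       dot (qmul x w) (qmul y w) = 0 & dot (qmul y z) (qmul y w) = 0] &
    dot (qmul y z) (qmul x w) = - dot (qmul y w) (qmul x z)].
Proof.
move=> xx yy xy zz ww zw; split.
- by split; rewrite dot_qmul2l ?xx ?yy ?zz ?ww mulr1.
- by split; rewrite ?dot_qmul2l ?dot_qmul2r ?zw ?xy ?mulr0 ?mul0r.
- have := dot_qmul_polar x y z w; rewrite xy zw mulr0 mulr0 (dotC (qmul y w)); lra.
Qed.

(** This is [gram_qmul] for the orthonormal frames (a, a') and (b, b'), with C = <a' b', a b>. *)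
Lemma gram_surface s t : I s -> J t ->
  [/\ dot (qmul (derive1 a s) (b t)) (qmul (derive1 a s) (b t)) = 1,
      dot (qmul (a s) (derive1 b t)) (qmul (a s) (derive1 b t)) = 1,
      dot (qmul (derive1 a s) (b t)) (qmul (a s) (derive1 b t)) = - C,
      dot (qmul (a s) (b t)) (qmul (derive1 a s) (b t)) = 0 &
      dot (qmul (a s) (b t)) (qmul (a s) (derive1 b t)) = 0].
Proof.
move=> Is Jt; have := dot_T _ _ Is Jt; rewrite /T_alpha /T_beta dot_qmul_qconj => <-.
have [-> ->] := aE _ Is; have [-> ->] := bE _ Jt.
have [xx yy xy] := orthonormal_rot _ _ s pp uu pu.
have [zz ww zw] := orthonormal_rot _ _ t qq vv qv.
by have [[]] := gram_qmul _ _ _ _ xx yy xy zz ww zw => ? ? ? ? [].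
Qed.

Lemma partial_product0 s t : I s -> J t -> partial X 0 s t = qmul (derive1 a s) (b t).
Proof.
move=> Is Jt; rewrite /partial/=.
rewrite (derive1_linear_circle _ _ _ _ oI aE (fun x => 1 *: qmul x (b t))
  (fun x => 0 *: qmul x (b t)))//.
- by rewrite scale1r scale0r subr0.
- exact: linear_qmull.
- exact: linear_qmull.
- by move=> x _; rewrite scale1r scale0r addr0.
Qed.

Lemma partial_product1 s t : I s -> J t -> partial X 1 s t = qmul (a s) (derive1 b t).
Proof.
move=> Is Jt; rewrite /partial/=.
rewrite (derive1_linear_circle _ _ _ _ oJ bE (fun x => 1 *: qmul (a s) x)
  (fun x => 0 *: qmul (a s) x))//.
- by rewrite scale1r scale0r subr0.
- exact: linear_qmulr.
- exact: linear_qmulr.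
- by move=> x _; rewrite scale1r scale0r addr0.
Qed.

Let w := Num.sqrt (1 - C ^+ 2).

(** By [dot_T] the coefficients in the normal are constant on the domain, so for fixed t it is a
    linear expression in a and a', namely (a' b' - C a b) / w. *)
Lemma derive1_normal0 s t : I s -> J t -> derive1 (N ^~ t) s =
  - (C / w) *: qmul (derive1 a s) (b t) - w^-1 *: qmul (a s) (derive1 b t).
Proof.
move=> Is Jt.
rewrite (derive1_linear_circle _ _ _ _ oI aE (fun x => - (C / w) *: qmul x (b t))
  (fun x => w^-1 *: qmul x (derive1 b t)))//.
- exact: linear_qmull.
- exact: linear_qmull.
- move=> x /set_mem Ix; rewrite /N /unit_normal dot_T// -/w scalerBr scalerA addrC.
  by rewrite scaleNr mulrC.
Qed.

Lemma derive1_normal1 s t : I s -> J t -> derive1 (N s) t =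
  - (C / w) *: qmul (a s) (derive1 b t) - w^-1 *: qmul (derive1 a s) (b t).
Proof.
move=> Is Jt.
rewrite (derive1_linear_circle _ _ _ _ oJ bE (fun x => - (C / w) *: qmul (a s) x)
  (fun x => w^-1 *: qmul (derive1 a s) x))//.
- exact: linear_qmulr.
- exact: linear_qmulr.
- move=> x /set_mem Jx; rewrite /N /unit_normal dot_T// -/w scalerBr scalerA addrC.
  by rewrite scaleNr mulrC.
Qed.

Hypothesis reg : regular_surface I J X.

Lemma lt1_dot_T s t : I s -> J t -> -1 < C < 1.
Proof.
move=> Is Jt; have := reg s t Is Jt; rewrite partial_product0// partial_product1//.
have [h1 h2 h3 _ _] := gram_surface _ _ Is Jt.
move=> /sqr_lt1_of_free/(_ h1 h2 h3) /andP[? ?].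
by apply/andP; split; lra.
Qed.

Lemma mean_curvature_product s t : I s -> J t -> mean_curvature X N s t = - C / w.
Proof.
move=> Is Jt; have C1 := lt1_dot_T _ _ Is Jt.
have [ss tt st xs xt] := gram_surface _ _ Is Jt.
have w0 : w != 0.
  by rewrite gt_eqF// sqrtr_gt0; case/andP: C1 => ? ?; nra.
have w2 : w ^+ 2 = 1 - C ^+ 2.
  by rewrite sqr_sqrtr//; case/andP: C1 => ? ?; nra.
have wE : (C ^+ 2 - 1) / w = - w.
  by rewrite -opprB -w2 expr2 mulNr mulfK.
(* Here [e] and [f] are the coordinate tangent vectors and [n] is the position, whose component is
   removed by the covariant derivative. The t-direction uses the same computation with [e] and [f]
   exchanged. *)
have shape (e f n : 'rV[R]_4) k : dot e e = 1 -> dot f f = 1 -> dot e f = - C ->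
    dot n e = 0 -> dot n f = 0 -> let V := - (C / w) *: e - w^-1 *: f - k *: n in
    dot V e = 0 /\ dot V f = - w.
  move=> ee ff ef ne nf V; rewrite /V !(dotDl, dotNl, dotZl) (dotC f) ee ff ef ne nf.
  by split; [ring|rewrite -wE; ring].
have ts := st; rewrite dotC in ts.
have N0 : cov_partial X N 0 s t = cov_deriv (X ^~ t) (N ^~ t) s
  by exact: cov_partialE0.
have N1 : cov_partial X N 1 s t = cov_deriv (X s) (N s) t
  by exact: cov_partialE1.
rewrite /cov_deriv derive1_normal0// in N0; rewrite /cov_deriv derive1_normal1// in N1.
have [S00 S01] := shape _ _ _ (dot (- (C / w) *: qmul (derive1 a s) (b t) -
  w^-1 *: qmul (a s) (derive1 b t)) (X s t)) ss tt st xs xt.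
have [S11 S10] := shape _ _ _ (dot (- (C / w) *: qmul (a s) (derive1 b t) -
  w^-1 *: qmul (derive1 a s) (b t)) (X s t)) tt ss ts xt xs.
by apply: half_trace_shape_operator => //;
  rewrite mxE ?N0 ?N1 ?partial_product0 ?partial_product1.
Qed.

Lemma is_clifford_torus_product : -1 < C < 1 -> is_clifford_torus I J X.
Proof.
move=> /andP[C1 C2].
pose R1 := Num.sqrt ((1 - C) / 2); pose R2 := Num.sqrt ((1 + C) / 2).
have R1_gt0 : 0 < R1 by rewrite sqrtr_gt0; lra.
have R2_gt0 : 0 < R2 by rewrite sqrtr_gt0; lra.
have R1E : R1 ^+ 2 = (1 - C) / 2 by rewrite sqr_sqrtr//; lra.
have R2E : R2 ^+ 2 = (1 + C) / 2 by rewrite sqr_sqrtr//; lra.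
have R1n : R1 != 0 by rewrite gt_eqF.
have R2n : R2 != 0 by rewrite gt_eqF.
(* These are the orthogonal vectors of the addition formulas, with squared norms 4 R1^2 for [e1],
   [e2] and 4 R2^2 for [e3], [e4]; dividing by 2 R1 and 2 R2 makes the rows of [A] orthonormal. *)
pose e1 := qmul p q - qmul u v; pose e2 := qmul p v + qmul u q.
pose e3 := qmul p q + qmul u v; pose e4 := qmul u q - qmul p v.
pose A : 'M[R]_4 := \matrix_(i < 4) [:: (2 * R1)^-1 *: e1; (2 * R1)^-1 *: e2;
  (2 * R2)^-1 *: e3; (2 * R2)^-1 *: e4]`_i.
apply: (is_clifford_torus_of_angles I J X A R1 R2) => //.
- have [[pqpq pvpv uquq uvuv] [pqpv pquq pvuv uquv] uqpv] :=
    gram_qmul _ _ _ _ pp uu pu qq vv qv.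
  have rowE i j : (A *m A^T) i j = dot (row i A) (row j A).
    by rewrite mxE; apply: eq_bigr => k _; rewrite !mxE.
  have r0 : row 0 A = (2 * R1)^-1 *: e1 by apply/rowP => j; rewrite !mxE.
  have r1 : row 1 A = (2 * R1)^-1 *: e2 by apply/rowP => j; rewrite !mxE.
  have r2 : row 2 A = (2 * R2)^-1 *: e3 by apply/rowP => j; rewrite !mxE.
  have r3 : row 3 A = (2 * R2)^-1 *: e4 by apply/rowP => j; rewrite !mxE.
  have dots := (pqpq, pvpv, uquq, uvuv, pqpv, pquq, pvuv, uquv, uqpv).
  have s1 : (2 * R1)^-1 * (2 * R1)^-1 * (2 - 2 * C) = 1.
    by rewrite -invfM -expr2 exprMn R1E; field; lra.
  have s2 : (2 * R2)^-1 * (2 * R2)^-1 * (2 + 2 * C) = 1.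
    by rewrite -invfM -expr2 exprMn R2E; field; lra.
  have comm : (dot (qmul u v) (qmul p q) = C) * (dot (qmul p q) (qmul u v) = C) *
    (dot (qmul p v) (qmul p q) = 0) * (dot (qmul u q) (qmul p q) = 0) *
    (dot (qmul u v) (qmul p v) = 0) * (dot (qmul u v) (qmul u q) = 0) *
    (dot (qmul p v) (qmul u q) = - C).
    by do ![split]; rewrite ?[dot (qmul p q) (qmul u v)]dotC// dotC ?dots.
  apply/matrixP => i j; rewrite rowE mxE.
  elim/forall_ord4: i; elim/forall_ord4: j;
    rewrite ?r0 ?r1 ?r2 ?r3 /e1 /e2 /e3 /e4 /=;
    rewrite !(dotZl, dotZr, dotDl, dotDr, dotNl, dotNr) ?dots ?comm;
    by [rewrite -[RHS]s1; ring|rewrite -[RHS]s2; ring|ring].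
- by rewrite R1E R2E; field.
- move=> s t Is Jt; rewrite /X /product_map.
  have [-> _] := aE _ Is; have [-> _] := bE _ Jt.
  rewrite !(qmulDl, qmulDr, qmulZl, qmulZr).
  apply/rowP => j; rewrite [in RHS]mxE sum_ord4 /torus_point /A.
  rewrite ![(\matrix_i _) _ _]mxE ![(\row_i _) _ _]mxE /= cosD sinD cosB sinB.
  rewrite /e1 /e2 /e3 /e4.
  move: (qmul p q) (qmul p v) (qmul u q) (qmul u v) => E1 E2 E3 E4.
  rewrite !mxE; field.
  by rewrite R1n R2n.
Qed.

End TranslationSurface.

(** * Empty parameter domains and the conclusion *)

Lemma is_clifford_torus_empty {R : realType} (I J : set R) (X : R -> R -> 'rV[R]_4) :
  (forall s t, I s -> J t -> False) -> is_clifford_torus I J X.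
Proof.
(* The empty image is the trace of the empty set on any torus; a Pythagorean triple supplies
   rational radii. *)
move=> IJ0; exists (3 / 5), (4 / 5), (fun x => x *m 1%:M), set0.
split; first by split; [lra|lra|field].
split; [|exact: open0|].
  by apply: mulmx_orthogonal_sphere_isometry; rewrite trmx1 mulmx1.
rewrite set0I; apply/seteqP; split=> // x [s Is [t Jt _]].
exact: (IJ0 s t Is Jt).
Qed.

Theorem theorem4p1 (R : realType) (I J : set R) (a b : R -> 'rV[R]_4)
    (hX : translation_surface I J a b)
    (ka : forall s, I s -> curvature a s = 0)
    (kb : forall t, J t -> curvature b t = 0) :
  let X := product_map a b in
  let N := unit_normal a b in
  is_clifford_torus I J X /\ cmc I J X N /\
  exists C : R,
    [/\ -1 < C < 1,
        forall s t, I s -> J t -> dot (T_alpha a s) (T_beta b t) = C &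
        forall s t, I s -> J t -> mean_curvature X N s t = - C / Num.sqrt (1 - C ^+ 2)].
Proof.
move=> X N; have [[oI iI oJ iJ] [arcA arcB reg]] := hX.
suff [tor [C [C1 TC HC]]] : is_clifford_torus I J X /\ exists C : R,
    [/\ -1 < C < 1,
        forall s t, I s -> J t -> dot (T_alpha a s) (T_beta b t) = C &
        forall s t, I s -> J t -> mean_curvature X N s t = - C / Num.sqrt (1 - C ^+ 2)].
  split=> //; split; last by exists C; split.
  by exists (- C / Num.sqrt (1 - C ^+ 2)).
(* An empty domain offers no base point for [great_circle]; every constant in (-1, 1) then works,
   and 0 is chosen. *)
have [IJ0|] := pselect (forall s t, I s -> J t -> False).
  split; first exact: is_clifford_torus_empty.
  exists 0; split=> [|s t Is Jt|s t Is Jt]; [|by case: (IJ0 s t)..].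
  by apply/andP; split; lra.
move=> /existsNP[s0 /existsNP[t0 /not_implyP[Is0 /not_implyP[Jt0 _]]]].
have [p [u [pp uu pu aE]]] := great_circle _ _ oI iI arcA ka Is0.
have [q [v [qq vv qv bE]]] := great_circle _ _ oJ iJ arcB kb Jt0.
pose C := dot (qmul u v) (qmul p q).
have C1 : -1 < C < 1.
  exact: (lt1_dot_T _ _ _ _ _ _ _ _ oI oJ pp uu pu qq vv qv aE bE reg _ _ Is0 Jt0).
split; first exact: (is_clifford_torus_product _ _ _ _ _ _ _ _ oI oJ pp uu pu qq vv qv aE bE C1).
exists C; split=> // s t Is Jt.
  exact: (dot_T _ _ _ _ _ _ _ _ pp uu pu qq vv qv aE bE _ _ Is Jt).
exact: (mean_curvature_product _ _ _ _ _ _ _ _ oI oJ pp uu pu qq vv qv aE bE reg _ _ Is Jt).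
Qed.
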